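(* Let $V$ be a superspace and let $a,b,c$ be $\mathrm{End}(V)$-valued fields. Then for every $n\in\mathbb{Z}$, $$[a_\lambda(b_{(n)}c)]=\sum_{k\in\mathbb{Z}^+}\frac{\lambda^k}{k!}[a_\lambda b]_{(n+k)}c+p(a,b)\,b_{(n)}[a_\lambda c].$$
   Context: All vector spaces are over $\mathbb{C}$; $\mathbb{Z}^+=\{0,1,2,\dots\}$. $\mathrm{End}(V)$ is an associative superalgebra, also a Lie superalgebra with $[x,y]=xy-p(x,y)yx$, where $p(x,y)=(-1)^{p(x)p(y)}$. A formal distribution $a(z)=\sum_{n\in\mathbb{Z}}a_{(n)}z^{-n-1}$ has all modes of the same parity, which is its parity; it is an $\mathrm{End}(V)$-valued field if $a(z)v\in V[[z]][z^{-1}]$ for all $v\in V$. $\mathrm{Res}_z$ is the coefficient of $z^{-1}$. For $n\in\mathbb{Z}$ the generalized $n$-product of fields is $$a(w)_{(n)}b(w)=\mathrm{Res}_z\left(i_{z,w}(z-w)^n\,a(z)b(w)-p(a,b)\,i_{w,z}(z-w)^n\,b(w)a(z)\right),$$ with $i_{z,w}(z-w)^n=\sum_{j\ge0}\binom nj(-w)^jz^{n-j}$ and $i_{w,z}(z-w)^n=\sum_{j\ge0}\binom njz^j(-w)^{n-j}$, $\binom nj=n(n-1)\cdots(n-j+1)/j!$. It is again a field. The $\lambda$-bracket is $[a_\lambda b]=\mathrm{Res}_z\,e^{\lambda(z-w)}[a(z),b(w)]=\sum_{j\ge0}\frac{\lambda^j}{j!}a_{(j)}b$, a formal power series in $\lambda$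 with coefficients formal distributions in $w$. Products of formal power series in $\lambda$ with fields are taken coefficientwise in $\lambda$. *)

(* Defs.v *)
From HB Require Import structures.
From mathcomp Require Import all_boot all_order all_algebra.
From mathcomp Require Import boolp classical_sets functions cardinality.
From mathcomp Require Import fsbigop reals complex zify.

Set Implicit Arguments.
Unset Strict Implicit.
Unset Printing Implicit Defensive.

Import Order.TTheory GRing.Theory Num.Theory.
Local Open Scope classical_set_scope.
Local Open Scope ring_scope.

(* Vector superspaces, with no dimension hypothesis.  Parities are booleans:
   [false] is even, [true] is odd, and they are added with [(+)]. *)
HB.mixin Record Lmodule_isSuper (K : fieldType) V of GRing.Lmodule K V := {
  spart : bool -> set V;
  spart0 : forall p, spart p 0;
  spart_linear : forall p (x : K) (u v : V),
    spart p u -> spart p v -> spart p (x *: u + v);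
  spart_disj : spart false `&` spart true `<=` [set 0];
  spart_span : forall v : V,
    exists u0 u1, [/\ spart false u0, spart true u1 & v = u0 + u1]
}.

#[short(type="superspaceType")]
HB.structure Definition SuperSpace (K : fieldType) :=
  {V of GRing.Lmodule K V & Lmodule_isSuper K V}.

(* An End(V)-valued field [\sum_n a_(n) z^(-n-1)], where [a_(n)] is [mode a n].
   The parity is part of the data, so that the sign [p(a,b)] is also defined
   when all the modes vanish. *)
Record sfield (K : fieldType) (V : superspaceType K) := SField {
  mode : int -> {linear V -> V};
  parity : bool;
  mode_parity : forall n q u, spart q u -> spart (parity (+) q) (mode n u);
  mode_trunc : forall v, exists N : int, forall n, N <= n -> mode n v = 0
}.

Section FormalDistributions.
Context {K : fieldType} {V : superspaceType K}.
Implicit Types (a b c : sfield V) (n m i j : int) (u v : V).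

Definition psign a b : K := (-1) ^+ (parity a && parity b).

Definition coef a i : V -> V := mode a (- i - 1).

(* Formal series in [z^(+-1)], [w^(+-1)] whose coefficients are operators on V:
   [A i j] is the coefficient of [z^i w^j].  Linearity is not bundled here;
   it is proved for the series that become fields below. *)
Definition series2 := int -> int -> V -> V.

Definition prod_zw a b : series2 := fun i j v => coef a i (coef b j v).
Definition prod_wz b a : series2 := fun i j v => coef b j (coef a i v).

Definition superbracket a b : series2 :=
  prod_zw a b - psign a b *: prod_wz b a.

Definition gbinom n (k : nat) : K :=
  (\prod_(l < k) (n%:~R - l%:R)) / k`!%:R.

(* Multiplication by [i_{z,w}(z-w)^n] and by [i_{w,z}(z-w)^n].  The sums over
   [k] are finitely supported sums in V, after evaluation at a vector. *)
Definition mul_izw n (A : series2) : series2 := fun i j v =>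
  \sum_(k \in [set: nat])
    (gbinom n k * (-1) ^+ k) *: A (i - (n - k%:Z)) (j - k%:Z) v.

Definition mul_iwz n (A : series2) : series2 := fun i j v =>
  \sum_(k \in [set: nat])
    (gbinom n k * (-1) ^ (n - k%:Z)) *: A (i - k%:Z) (j - (n - k%:Z)) v.

(* The coefficient of [w^(-m-1)] in [Res_z A]. *)
Definition res_mode (A : series2) m : V -> V := A (-1) (- m - 1).

Definition nprod_mode n a b m : V -> V :=
  res_mode (mul_izw n (prod_zw a b) - psign a b *: mul_iwz n (prod_wz b a)) m.

Definition mul_zw (A : series2) : series2 := fun i j =>
  A (i - 1) j - A i (j - 1).

(* The coefficient of [lambda^k] in [e^(lambda (z-w)) A]. *)
Definition exp_coef (k : nat) (A : series2) : series2 :=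
  (k`!%:R^-1 : K) *: iter k mul_zw A.

Definition lambda_mode a b (k : nat) m : V -> V :=
  res_mode (exp_coef k (superbracket a b)) m.

Lemma spartD p u v : spart p u -> spart p v -> spart p (u + v).
Proof. by move=> pu pv; rewrite -[u]scale1r; apply: spart_linear. Qed.

Lemma spartZ p (x : K) u : spart p u -> spart p (x *: u).
Proof. by move=> pu; rewrite -[_ *: _]addr0; apply/spart_linear/spart0. Qed.

Lemma spart_sum p (N : nat) (F : 'I_N -> V) :
  (forall k, spart p (F k)) -> spart p (\sum_k F k).
Proof.
by move=> pF; elim/big_ind: _ => [|u v|k _]; [exact: spart0|exact: spartD|].
Qed.

Lemma fsum_nat (N : nat) (F : nat -> V) : (forall k, (N <= k)%N -> F k = 0) ->
  \sum_(k \in [set: nat]) F k = \sum_(k < N) F k.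
Proof.
move=> F0; rewrite [RHS]fsbig_ord; apply/esym/fsbig_widen => // k [_ /= kN].
by apply: F0; rewrite leqNgt; apply/negP.
Qed.

Lemma sfield_trunc_nat a v :
  exists N : nat, forall n, N%:Z <= n -> mode a n v = 0.
Proof.
have [N aN] := mode_trunc a v; exists `|N|%N => n Nn; apply: aN.
by apply: le_trans Nn; rewrite abszE ler_norm.
Qed.

Lemma coef_linear a i : linear (coef a i).
Proof. by move=> x u v; rewrite /coef linearP. Qed.

Lemma coef_parity a i q u : spart q u -> spart (parity a (+) q) (coef a i u).
Proof. exact: mode_parity. Qed.

Lemma nprod_modeE n a b m v : exists N0 : nat, forall N, (N0 <= N)%N ->
  nprod_mode n a b m v =
    \sum_(k < N) (gbinom n k * (-1) ^+ k) *: mode a (n - k%:Z) (mode b (m + k%:Z) v)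
    - psign a b *: \sum_(k < N)
        (gbinom n k * (-1) ^ (n - k%:Z)) *: mode b (m + n - k%:Z) (mode a k%:Z v).
Proof.
have [Na aN] := sfield_trunc_nat a v; have [Nb bN] := sfield_trunc_nat b v.
exists (maxn Na (Nb + `|m|))%N => N; rewrite geq_max => /andP[NaN NbN].
have e1 (k : nat) : - (-1 - (n - k%:Z)) - 1 = n - k%:Z by lia.
have e2 (k : nat) : - (- m - 1 - k%:Z) - 1 = m + k%:Z by lia.
have e3 (k : nat) : - (-1 - k%:Z) - 1 = k%:Z by lia.
have e4 (k : nat) : - (- m - 1 - (n - k%:Z)) - 1 = m + n - k%:Z by lia.
rewrite /nprod_mode /res_mode.
rewrite [LHS](_ : _ = mul_izw n (prod_zw a b) (-1) (- m - 1) v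
   - psign a b *: mul_iwz n (prod_wz b a) (-1) (- m - 1) v) //.
congr (_ - _ *: _).
- rewrite /mul_izw (@fsum_nat N).
    by apply: eq_bigr => k _; rewrite /prod_zw /coef e1 e2.
  move=> k Nk; rewrite /prod_zw /coef e2 bN ?linear0 ?scaler0 //.
  by have := leq_trans NbN Nk; lia.
- rewrite /mul_iwz (@fsum_nat N).
    by apply: eq_bigr => k _; rewrite /prod_wz /coef e3 e4.
  move=> k Nk; rewrite /prod_wz /coef e3 aN ?linear0 ?scaler0 //.
  by rewrite lez_nat (leq_trans NaN).
Qed.

Lemma nprod_mode_linear n a b m : linear (nprod_mode n a b m).
Proof.
move=> x u v.
have [N1 E1] := nprod_modeE n a b m u; have [N2 E2] := nprod_modeE n a b m v.
have [N3 E3] := nprod_modeE n a b m (x *: u + v).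
set N := maxn N1 (maxn N2 N3).
rewrite (E1 N) ?(E2 N) ?(E3 N) ?leq_max ?leqnn ?orbT //.
rewrite scalerBr addrACA -opprD scalerA [x * _]mulrC -scalerA -scalerDr.
congr (_ - _ *: _); rewrite scaler_sumr -big_split /=;
by apply: eq_bigr => k _; do 2![rewrite linearP]; rewrite scalerDr !scalerA mulrC.
Qed.

Lemma nprod_mode_parity n a b m q u :
  spart q u -> spart ((parity a (+) parity b) (+) q) (nprod_mode n a b m u).
Proof.
move=> qu; have [N /(_ N (leqnn N)) ->] := nprod_modeE n a b m u.
rewrite -scaleNr; apply: spartD; last apply: spartZ; apply: spart_sum => k;
  apply: spartZ.
- by rewrite -addbA; do 2![apply: mode_parity].
- by rewrite [parity a (+) _]addbC -addbA; do 2![apply: mode_parity].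
Qed.

Lemma nprod_mode_trunc n a b v :
  exists N : int, forall m, N <= m -> nprod_mode n a b m v = 0.
Proof.
have [Na aN] := sfield_trunc_nat a v; have [Nb bN] := sfield_trunc_nat b v.
have [M bM] : exists M : int, forall m (k : nat), (k < Na)%N -> M <= m ->
    mode b (m + n - k%:Z) (mode a k%:Z v) = 0.
  clear aN; elim: Na => [|N [M IH]]; first by exists 0.
  have [M' bM'] := mode_trunc b (mode a N%:Z v).
  exists (Num.max M (M' - n + N%:Z)) => m k; rewrite ge_max ltnS => kN /andP[Mm M'm].
  move: kN; rewrite leq_eqVlt => /predU1P[->|kN]; last exact: IH.
  by apply: bM'; rewrite lerBrDr -lerBlDr addrAC.
exists (Num.max M Nb%:Z) => m; rewrite ge_max => /andP[Mm Nbm].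
have [N /(_ N (leqnn N)) ->] := nprod_modeE n a b m v.
rewrite !big1 ?scaler0 ?subr0 // => k _.
- have [kNa|Nak] := ltnP k Na; first by rewrite bM ?scaler0.
  by rewrite aN ?linear0 ?scaler0 // lez_nat.
- by rewrite bN ?linear0 ?scaler0 // (le_trans Nbm) // lerDl.
Qed.

HB.instance Definition _ n a b m :=
  GRing.isLinear.Build K V V *:%R (nprod_mode n a b m)
    (@nprod_mode_linear n a b m).

Definition nprod n a b : sfield V :=
  @SField K V (fun m => nprod_mode n a b m) (parity a (+) parity b)
    (@nprod_mode_parity n a b) (@nprod_mode_trunc n a b).

Lemma prod_zw_trunc a b i v :
  exists N : int, forall j, j <= N -> prod_zw a b i j v = 0.
Proof.
have [N bN] := mode_trunc b v; exists (- N - 1) => j jN.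
by rewrite /prod_zw /coef bN ?linear0 // lerBrDr lerNr opprD.
Qed.

Lemma prod_wz_trunc a b i v :
  exists N : int, forall j, j <= N -> prod_wz b a i j v = 0.
Proof.
have [N bN] := mode_trunc b (coef a i v); exists (- N - 1) => j jN.
by rewrite /prod_wz {1}/coef bN // lerBrDr lerNr opprD.
Qed.

Lemma lambda_mode_prop (P : series2 -> Prop) a b (k : nat) :
  P (superbracket a b) -> (forall A, P A -> P (mul_zw A)) ->
  P (iter k mul_zw (superbracket a b)).
Proof. by move=> P0 PS; elim: k => //= k; apply: PS. Qed.

Lemma lambda_modeE a b k m v : lambda_mode a b k m v =
  k`!%:R^-1 *: iter k mul_zw (superbracket a b) (-1) (- m - 1) v.
Proof. by []. Qed.

Lemma lambda_mode_linear a b k m : linear (lambda_mode a b k m).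
Proof.
have lin i j : linear (iter k mul_zw (superbracket a b) i j).
  pose P (A : series2) := forall i j, linear (A i j).
  apply: (lambda_mode_prop (P := P)) => {i j} [i j|A PA i j] x u v.
  - rewrite /superbracket !fctE /prod_zw /prod_wz.
    rewrite !coef_linear scalerBr scalerDr !scalerA [x * _]mulrC.
    by rewrite opprD addrACA.
  - by rewrite /mul_zw !fctE !PA scalerBr opprD addrACA.
by move=> x u v; rewrite !lambda_modeE lin scalerDr !scalerA [x * _]mulrC.
Qed.

Lemma lambda_mode_parity a b k m q u :
  spart q u -> spart ((parity a (+) parity b) (+) q) (lambda_mode a b k m u).
Proof.
move=> qu; rewrite lambda_modeE; apply: spartZ.
pose P (A : series2) := forall i j,
  spart ((parity a (+) parity b) (+) q) (A i j u).
apply: (lambda_mode_prop (P := P)) => [i j|A PA i j].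
- rewrite /superbracket !fctE -scaleNr; apply: spartD; last apply: spartZ.
  + by rewrite -addbA; do 2![apply: coef_parity].
  + by rewrite [parity a (+) _]addbC -addbA; do 2![apply: coef_parity].
- by rewrite /mul_zw !fctE -scaleN1r; apply: spartD; last apply: spartZ.
Qed.

Lemma lambda_mode_trunc a b k v :
  exists N : int, forall m, N <= m -> lambda_mode a b k m v = 0.
Proof.
pose P (A : series2) := forall i,
  exists N : int, forall j, j <= N -> A i j v = 0.
have /(_ (-1))[N AN] : P (iter k mul_zw (superbracket a b)).
  apply: (lambda_mode_prop (P := P)) => [i|A PA i].
  - have [N1 E1] := prod_zw_trunc a b i v; have [N2 E2] := prod_wz_trunc a b i v.
    exists (Num.min N1 N2) => j; rewrite le_min => /andP[jN1 jN2].
    by rewrite /superbracket !fctE E1 ?E2 // scaler0 subr0.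
  - have [N1 E1] := PA (i - 1); have [N2 E2] := PA i.
    exists (Num.min N1 N2) => j; rewrite le_min => /andP[jN1 jN2].
    by rewrite /mul_zw !fctE E1 ?E2 ?subr0 // (le_trans _ jN2) // gerBl.
exists (- N - 1) => m Nm; rewrite lambda_modeE AN ?scaler0 //.
by rewrite lerBlDr lerNl opprD.
Qed.

HB.instance Definition _ a b k m :=
  GRing.isLinear.Build K V V *:%R (lambda_mode a b k m)
    (@lambda_mode_linear a b k m).

(* [[a_lambda b]]: the k-th value is the coefficient of [lambda^k]. *)
Definition lambda_bracket a b : nat -> sfield V := fun k =>
  @SField K V (fun m => lambda_mode a b k m) (parity a (+) parity b)
    (@lambda_mode_parity a b k) (@lambda_mode_trunc a b k).

(* Power series in lambda with coefficients distributions in w: [A k m] is the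
   m-th mode of the coefficient of [lambda^k].  These form a K-vector space
   for the pointwise operations. *)
Definition lseries := nat -> int -> V -> V.

Definition lseries_of (A : nat -> sfield V) : lseries := fun k m => mode (A k) m.

Definition lmulX (d : nat) (A : lseries) : lseries := fun k =>
  if (d <= k)%N then A (k - d)%N else 0.

Definition lsum (F : nat -> lseries) : lseries := fun k =>
  \sum_(d \in [set: nat]) F d k.

(* The n-products with a power series in lambda, coefficientwise. *)
Definition nprodsl n (A : nat -> sfield V) c : nat -> sfield V :=
  fun k => nprod n (A k) c.
Definition nprodsr n b (A : nat -> sfield V) : nat -> sfield V :=
  fun k => nprod n b (A k).

End FormalDistributions.

Arguments series2 {K} V.
Arguments lseries {K} V.

(* Main.v *)
Require Import Defs.
From HB Require Import structures.
From mathcomp Require Import all_boot all_order all_algebra.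
From mathcomp Require Import boolp classical_sets functions cardinality.
From mathcomp Require Import fsbigop reals complex zify ring.

Set Implicit Arguments.
Unset Strict Implicit.
Unset Printing Implicit Defensive.

Import Order.TTheory GRing.Theory Num.Theory.
Local Open Scope ring_scope.

(** The generating-function identity behind the theorem is
      [a(x), b(z)c(w)] = [a(x), b(z)] c(w) + p(a,b) b(z) [a(x), c(w)],
    multiplied by [exp(lambda (x-w)) = exp(lambda (x-z)) exp(lambda (z-w))]: the
    first exponential produces the lambda-bracket of [a] and [b], and the
    powers of [z-w] in the second raise the index [n] of the product to
    [n + k].

    Only two indeterminates are ever kept here, thanks to the operation [shift],
    multiplication of a field by its variable.  Write [L_k(a, b)] for the
    coefficient of [lambda^k] in the lambda-bracket of [a] and [b], and [W] for
    [shift].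
    - [L_0(a, _)] is the commutator with the mode [a_(0)], hence a
      superderivation of every [n]-product ([lambda_mode0_nprod]).
    - Multiplication by [x-w] reads
      [(k+1) L_(k+1)(a, b) = L_k(W a, b) - W L_k(a, b)] ([lambda_modeS]).
    - For [n]-products, [b_(n) (W c) = W (b_(n) c)] and
      [(W b)_(n) c - W (b_(n) c) = b_(n+1) c] ([nprod_shiftr], [nprod_shiftl]);
      the second one is Pascal's rule for [(z-w)^(n+1)].

    The theorem follows coefficient by coefficient, by induction on [k] with [a]
    universally quantified ([lambda_mode_nprod]).  Since [W] moves every mode
    of [a] into position [0], the recurrence never leaves the class of
    lambda-brackets. *)

(** * Signs, sums in modules, and Pascal's rule *)

Lemma subrBD (W : zmodType) (A B C D : W) : A - B - (C - D) = A + D - (B + C).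
Proof. by rewrite opprB addrACA -opprD. Qed.

Lemma subrBB (W : zmodType) (A B C D : W) : A - B - (C - D) = A - C - (B - D).
Proof. by rewrite !subrBD [B + C]addrC. Qed.

(** The shape in which the terms B and C, each the result of moving [a] past
    only one factor of a product, cancel between the two summands of a Leibniz
    rule. *)
Lemma subr_telescope (W : zmodType) (A B C D E F : W) :
  A - B - (C - D) + (B - E - (F - C)) = A - F - (E - D).
Proof. by rewrite !subrBD addrA subrK [E + F]addrC. Qed.

Lemma scaler_rearrange (K : comNzRingType) (W : lmodType K)
    (x y : K) (A B C D : W) :
  x *: (A - B) - y *: (x *: (C - D)) = x *: ((A - y *: C) - (B - y *: D)).
Proof.
rewrite scalerA [y * x]mulrC -scalerA -scalerBr; congr (x *: _).
by rewrite scalerBr subrBB.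
Qed.

Lemma sumZB (K : comNzRingType) (W : lmodType K) (N : nat) (x : K)
    (s : nat -> K) (E F G : nat -> W) :
  (forall k, E k = F k - x *: G k) ->
  \sum_(k < N) s k *: E k
  = \sum_(k < N) s k *: F k - x *: \sum_(k < N) s k *: G k.
Proof.
move=> EE; rewrite scaler_sumr -sumrB; apply: eq_bigr => k _.
by rewrite EE scalerBr !scalerA mulrC.
Qed.

Lemma sign_andb_addb (K : pzRingType) (x y z : bool) :
  (-1) ^+ (x && (y (+) z)) = (-1) ^+ (x && y) * (-1) ^+ (x && z) :> K.
Proof. by case: x; rewrite ?mulr1 //= signr_addb. Qed.

Lemma gbinom0 (K : numFieldType) (n : int) : gbinom n 0 = 1 :> K.
Proof. by rewrite /gbinom big_ord0 fact0 divr1. Qed.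

Lemma gbinomS (K : numFieldType) (n : int) k :
  gbinom (n + 1) k.+1 = gbinom n k.+1 + gbinom n k :> K.
Proof.
rewrite /gbinom big_ord_recl [in X in _ = X + _]big_ord_recr /=.
rewrite (eq_bigr (fun l : 'I_k => n%:~R - l%:R : K)); last first.
  by move=> l _; rewrite /bump /= intrD natrD; ring.
have k0 : k`!%:R != 0 :> K by rewrite pnatr_eq0 -lt0n fact_gt0.
have k1 : k%:R + 1 != 0 :> K by rewrite natr1 pnatr_eq0.
rewrite factS natrM -natr1 intrD.
by field; rewrite k1 k0.
Qed.

(** Multiplying [i (z-w)^n] once more by [z-w], read off on coefficients; [F] is
    the sequence of operator products and [s] carries the signs of either
    expansion.  The hypothesis [F N = 0] disposes of the term created by
    reindexing at the upper end of the truncated sums. *)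
Lemma pascal_sum (K : numFieldType) (W : lmodType K)
    (s : nat -> K) (F : nat -> W) (n : int) N :
  (forall k, s k.+1 = - s k) -> F N = 0 ->
  \sum_(k < N) (gbinom (n + 1) k * s k) *: F k
  = \sum_(k < N) (gbinom n k * s k) *: F k
    - \sum_(k < N) (gbinom n k * s k) *: F k.+1.
Proof.
case: N => [|N] sN F0; first by rewrite !big_ord0 subr0.
rewrite [X in _ - X]big_ord_recr /= F0 scaler0 addr0.
rewrite !big_ord_recl !gbinom0 -addrA -sumrB /=; congr (_ + _).
apply: eq_bigr => k _; rewrite /bump /= add1n gbinomS mulrDl scalerDl.
by rewrite !sN !mulrN !scaleNr.
Qed.

(** Pascal's rule in divided powers.  On the right, split the factor [k + 1] of
    the [d]-th term as [(k + 1 - d) + d]: the first part loses its last term,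
    the second its first term and one step of the factorial. *)
Lemma fact_sum_recr (K : numFieldType) (W : lmodType K) (T : nat -> W) k :
  \sum_(d < k.+1) d`!%:R^-1 *: ((k - d).+1%:R *: T d + T d.+1)
  = k.+1%:R *: \sum_(d < k.+2) (d`!%:R^-1 : K) *: T d.
Proof.
rewrite (eq_bigr (fun d : 'I_k.+1 => d`!%:R^-1 *: ((k.+1 - d)%:R *: T d)
    + d.+1`!%:R^-1 *: (d.+1%:R *: T d.+1))); last first.
  move=> d _; rewrite scalerDr subSn -1?ltnS //; congr (_ + _).
  rewrite scalerA factS natrM invfM mulrAC mulVf ?mul1r //.
  by rewrite pnatr_eq0.
rewrite big_split /=.
have -> : \sum_(d < k.+1) (d`!%:R^-1 : K) *: ((k.+1 - d)%:R *: T d)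
   = \sum_(d < k.+2) (d`!%:R^-1 : K) *: ((k.+1 - d)%:R *: T d).
  by rewrite [RHS]big_ord_recr /= subnn scale0r scaler0 addr0.
have -> : \sum_(d < k.+1) (d.+1`!%:R^-1 : K) *: (d.+1%:R *: T d.+1)
   = \sum_(d < k.+2) (d`!%:R^-1 : K) *: (d%:R *: T d).
  by rewrite [RHS]big_ord_recl /= scale0r scaler0 add0r.
rewrite -big_split scaler_sumr; apply: eq_bigr => d _ /=.
by rewrite -scalerDr -scalerDl -natrD subnK -1?ltnS // !scalerA mulrC.
Qed.

(** * Finitely supported sums *)

Lemma fsum_ord (W : zmodType) (N : nat) (F : nat -> W) :
  (forall k, (N <= k)%N -> F k = 0) ->
  \sum_(k \in [set: nat]) F k = \sum_(k < N) F k.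
Proof.
move=> F0; rewrite [RHS]fsbig_ord; apply/esym/fsbig_widen => // k [_ /= kN].
by apply: F0; rewrite leqNgt; apply/negP.
Qed.

(** * Multiplication of a field by its variable *)

Section Fields.
Context {K : numFieldType} {V : superspaceType K}.
Implicit Types (a b c f g h : sfield V) (n m i : int) (u v : V).

Fact shift_parity a m q u :
  spart q u -> spart (parity a (+) q) (mode a (m + 1) u).
Proof. exact: mode_parity. Qed.

Fact shift_trunc a v :
  exists N : int, forall m, N <= m -> mode a (m + 1) v = 0.
Proof.
by have [N aN] := mode_trunc a v; exists N => m Nm; apply: aN; lia.
Qed.

Definition shift a : sfield V :=
  @SField K V (fun m => mode a (m + 1)) (parity a)
    (@shift_parity a) (@shift_trunc a).

Lemma nprod_shiftr n b c m v :
  nprod_mode n b (shift c) m v = nprod_mode n b c (m + 1) v.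
Proof.
have [N1 E1] := nprod_modeE n b (shift c) m v.
have [N2 E2] := nprod_modeE n b c (m + 1) v.
rewrite (E1 (maxn N1 N2)) ?(E2 (maxn N1 N2)) ?leq_maxl ?leq_maxr //.
congr (_ - _ *: _); apply: eq_bigr => k _ /=.
- by rewrite addrAC.
- by congr (_ *: mode c _ _); lia.
Qed.

(** In [Res_z], the factor [z] on [f(z)] is split as [(z-w) + w].  The same
    rule serves both expansions of [(z-w)^(n+1)], up to one sign in the second. *)
Lemma nprod_shiftl n f c m v :
  nprod_mode n (shift f) c m v - nprod_mode n f c (m + 1) v
  = nprod_mode (n + 1) f c m v.
Proof.
have [N1 E1] := nprod_modeE (n + 1) f c m v.
have [N2 E2] := nprod_modeE n (shift f) c m v.
have [N3 E3] := nprod_modeE n f c (m + 1) v.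
have [Nf fN] := sfield_trunc_nat f v; have [Nc cN] := sfield_trunc_nat c v.
(* Beyond [Nf] and [Nc + |m|] the boundary terms of Pascal's rule vanish. *)
pose N := (N1 + (N2 + N3) + (Nf + (Nc + `|m|)))%N.
rewrite (E1 N) ?(E2 N) ?(E3 N); try by rewrite /N; lia.
rewrite (pascal_sum (s := fun k => (-1) ^+ k)
  (F := fun k => mode f (n + 1 - k%:Z) (mode c (m + k%:Z) v))); first last.
- by rewrite cN ?linear0 // /N; lia.
- by move=> k; rewrite exprS mulN1r.
have sgnS i : (-1) ^ (i + 1) = - (-1) ^ i :> K.
  by rewrite expfzDr ?oppr_eq0 ?oner_eq0 // expr1z mulrN1.
rewrite (_ : \sum_(k < N) (gbinom (n + 1) k * (-1) ^ (n + 1 - k%:Z)) *: _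
  = - \sum_(k < N) (gbinom (n + 1) k * (-1) ^ (n - k%:Z)) *:
        mode c (m + (n + 1) - k%:Z) (mode f k%:Z v)); last first.
  rewrite -sumrN; apply: eq_bigr => k _.
  by rewrite addrAC sgnS mulrN scaleNr.
rewrite (pascal_sum (s := fun k => (-1) ^ (n - k%:Z))
  (F := fun k => mode c (m + (n + 1) - k%:Z) (mode f k%:Z v))); first last.
- by rewrite fN ?linear0 // /N; lia.
- move=> k; have -> : n - k%:Z = n - k.+1%:Z + 1 by lia.
  by rewrite sgnS opprK.
rewrite subrBB -scalerBr opprB /=.
congr (_ - _ - _ *: (_ - _)); apply: eq_bigr => k _.
- by congr (_ *: mode f _ _); lia.
- by congr (_ *: mode f _ (mode c _ _)); lia.
- by congr (_ *: mode c _ (mode f _ _)); lia.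
- by congr (_ *: mode c _ _); lia.
Qed.

(** * Linearity of the products in each factor *)

Lemma modeZB f i (x : K) u v :
  mode f i (x *: (u - v)) = x *: (mode f i u - mode f i v).
Proof. by rewrite linearZ linearB. Qed.

Lemma mode_sum f i (s : nat -> K) (F : nat -> V) N :
  mode f i (\sum_(k < N) s k *: F k) = \sum_(k < N) s k *: mode f i (F k).
Proof. by rewrite linear_sum; apply: eq_bigr => k _; rewrite linearZ. Qed.

(** Fields of a given parity are not bundled as a vector space, because the
    parity is part of a field; linearity of the product is therefore stated
    for three fields related mode by mode, in the shape of [lambda_modeS]. *)
Lemma nprod_lincombl (x : K) n f g h c m v :
  parity f = parity g -> parity f = parity h ->
  (forall i u, mode f i u = x *: (mode g i u - mode h i u)) ->
  nprod_mode n f c m v = x *: (nprod_mode n g c m v - nprod_mode n h c m v).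
Proof.
move=> fg fh fE.
have [N1 E1] := nprod_modeE n f c m v.
have [N2 E2] := nprod_modeE n g c m v.
have [N3 E3] := nprod_modeE n h c m v.
pose N := (N1 + (N2 + N3))%N.
rewrite (E1 N) ?(E2 N) ?(E3 N); try by rewrite /N; lia.
rewrite /psign -fg -fh -scaler_rearrange.
congr (_ - _ *: _); rewrite -sumrB scaler_sumr; apply: eq_bigr => k _;
  by rewrite fE ?modeZB -scalerBr !scalerA mulrC.
Qed.

Lemma nprod_lincombr (x : K) n b f g h m v :
  parity f = parity g -> parity f = parity h ->
  (forall i u, mode f i u = x *: (mode g i u - mode h i u)) ->
  nprod_mode n b f m v = x *: (nprod_mode n b g m v - nprod_mode n b h m v).
Proof.
move=> fg fh fE.
have [N1 E1] := nprod_modeE n b f m v.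
have [N2 E2] := nprod_modeE n b g m v.
have [N3 E3] := nprod_modeE n b h m v.
pose N := (N1 + (N2 + N3))%N.
rewrite (E1 N) ?(E2 N) ?(E3 N); try by rewrite /N; lia.
rewrite /psign -fg -fh -scaler_rearrange.
congr (_ - _ *: _); rewrite -sumrB scaler_sumr; apply: eq_bigr => k _;
  by rewrite fE ?modeZB -scalerBr !scalerA mulrC.
Qed.

(** * The coefficients of the lambda-bracket *)

Lemma lambda_mode0 a b m v :
  lambda_mode a b 0 m v
  = mode a 0 (mode b m v) - psign a b *: mode b m (mode a 0 v).
Proof.
rewrite lambda_modeE fact0 invr1 scale1r /= /superbracket !fctE.
rewrite /prod_zw /prod_wz /coef opprK addrN.
by congr (mode a 0 (mode b _ v) - _ *: mode b _ _); lia.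
Qed.

Lemma iter_mul_zw_shift a b k i j v :
  iter k mul_zw (superbracket (shift a) b) i j v
  = iter k mul_zw (superbracket a b) (i - 1) j v.
Proof.
elim: k i j => [|k IH] i j /=; last by rewrite /mul_zw !fctE !IH.
rewrite /superbracket !fctE /prod_zw /prod_wz /coef /=.
by congr (mode a _ _ - _ *: mode b _ (mode a _ v)); lia.
Qed.

(** One factor of the power [(z-w)^(k+1)] is distributed over the bracket; its
    [z] is absorbed in [a], which turns the mode [1] of [a] into a mode [0]. *)
Lemma lambda_modeS a b k m v :
  lambda_mode a b k.+1 m v
  = k.+1%:R^-1 *: (lambda_mode (shift a) b k m v - lambda_mode a b k (m + 1) v).
Proof.
rewrite !lambda_modeE iter_mul_zw_shift /= {1}/mul_zw !fctE.
rewrite factS natrM invfM -scalerA scalerBr; congr (_ *: (_ - _ *: _)).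
by congr (iter _ _ _ _ _ _); lia.
Qed.

(** The commutator with [a_(0)] is a superderivation of [End(V)], and the
    product is a combination of compositions of modes; the terms with [a_(0)]
    between [b] and [c] cancel. *)
Lemma lambda_mode0_nprod n a b c m v :
  lambda_mode a (nprod n b c) 0 m v
  = nprod_mode n (lambda_bracket a b 0) c m v
    + psign a b *: nprod_mode n b (lambda_bracket a c 0) m v.
Proof.
rewrite lambda_mode0 /=.
have [N1 E1] := nprod_modeE n b c m v.
have [N2 E2] := nprod_modeE n b c m (mode a 0 v).
have [N3 E3] := nprod_modeE n (lambda_bracket a b 0) c m v.
have [N4 E4] := nprod_modeE n b (lambda_bracket a c 0) m v.
pose N := (N1 + (N2 + (N3 + N4)))%N.
rewrite (E1 N) ?(E2 N) ?(E3 N) ?(E4 N); try by rewrite /N; lia.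
have p2 (x y : sfield V) : psign x y * psign x y = 1 :> K.
  by rewrite /psign -expr2 sqrr_sign.
have -> : psign a (nprod n b c) = psign a b * psign a c :> K.
  by rewrite /psign /= sign_andb_addb.
have -> : psign (lambda_bracket a b 0) c = psign a c * psign b c :> K.
  by rewrite /psign /= andbC sign_andb_addb ![parity c && _]andbC.
have -> : psign b (lambda_bracket a c 0) = psign a b * psign b c :> K.
  by rewrite /psign /= sign_andb_addb [parity b && parity a]andbC.
rewrite linearB linearZ.
pose s k : K := gbinom n k * (-1) ^+ k.
pose t k : K := gbinom n k * (-1) ^ (n - k%:Z).
rewrite (mode_sum _ _ s (fun k => mode b (n - k%:Z) (mode c (m + k%:Z) v))).
rewrite (mode_sum _ _ t (fun k => mode c (m + n - k%:Z) (mode b k%:Z v))).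
(* The sums in which [a_(0)] stands in the middle. *)
pose F1 k := mode b (n - k%:Z) (mode a 0 (mode c (m + k%:Z) v)).
pose F2 k := mode c (m + n - k%:Z) (mode a 0 (mode b k%:Z v)).
rewrite (sumZB N s (x := psign a b)
   (E := fun k => mode (lambda_bracket a b 0) (n - k%:Z) (mode c (m + k%:Z) v))
   (G := F1)
   (F := fun k => mode a 0 (mode b (n - k%:Z) (mode c (m + k%:Z) v)))); last first.
  by move=> k /=; rewrite lambda_mode0.
rewrite (sumZB N t (x := psign a b)
   (E := fun k => mode c (m + n - k%:Z) (mode (lambda_bracket a b 0) k%:Z v))
   (F := F2)
   (G := fun k => mode c (m + n - k%:Z) (mode b k%:Z (mode a 0 v)))); last first.
  by move=> k /=; rewrite lambda_mode0 linearB linearZ.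
rewrite (sumZB N s (x := psign a c)
   (E := fun k => mode b (n - k%:Z) (mode (lambda_bracket a c 0) (m + k%:Z) v))
   (F := F1)
   (G := fun k => mode b (n - k%:Z) (mode c (m + k%:Z) (mode a 0 v)))); last first.
  by move=> k /=; rewrite lambda_mode0 linearB linearZ.
rewrite (sumZB N t (x := psign a c)
   (E := fun k => mode (lambda_bracket a c 0) (m + n - k%:Z) (mode b k%:Z v))
   (G := F2)
   (F := fun k => mode a 0 (mode c (m + n - k%:Z) (mode b k%:Z v)))); last first.
  by move=> k /=; rewrite lambda_mode0.
rewrite !scalerBr !scalerA mulrA p2 mul1r.
rewrite [psign b c * psign a c]mulrC.
rewrite [psign a c * psign b c * psign a b]mulrC [psign a b * (_ * _)]mulrA.
exact/esym/subr_telescope.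
Qed.

(** * The Leibniz rule *)

(** By [lambda_modeS] the left side for [k + 1] is a difference of two left
    sides for [k].  In the [d]-th term of the sum, [nprod_shiftl] trades the
    outer shift for a shift of the bracket, which rebuilds the bracket of
    order [k - d + 1], at the cost of a product of index [n + d + 1], which
    belongs to the next term; [fact_sum_recr] collects the two
    contributions. *)
Lemma lambda_mode_nprod n a b c k m v :
  lambda_mode a (nprod n b c) k m v
  = \sum_(d < k.+1) (d`!%:R^-1 : K) *:
      nprod_mode (n + d%:Z) (lambda_bracket a b (k - d)) c m v
    + psign a b *: nprod_mode n b (lambda_bracket a c k) m v.
Proof.
elim: k a m => [|k IH] a m.
  by rewrite big_ord1 fact0 invr1 scale1r addr0 lambda_mode0_nprod.
have k0 (j : nat) : j.+1%:R != 0 :> K by rewrite pnatr_eq0.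
rewrite lambda_modeS !IH.
rewrite (@nprod_lincombr k.+1%:R^-1 n b (lambda_bracket a c k.+1)
  (lambda_bracket (shift a) c k) (shift (lambda_bracket a c k))) //;
  last by move=> i u; rewrite -lambda_modeS.
rewrite nprod_shiftr [psign (shift a) b]/psign -/(psign a b).
rewrite opprD addrACA -sumrB -scalerBr scalerDr; congr (_ + _); last first.
  by rewrite !scalerA mulrC.
apply: (scalerI (k0 k)); rewrite scalerA mulfV // scale1r.
rewrite -(fact_sum_recr
  (fun d => nprod_mode (n + d%:Z) (lambda_bracket a b (k.+1 - d)) c m v)).
apply: eq_bigr => d _; rewrite -scalerBr; congr (_ *: _).
have dk : (d <= k)%N by rewrite -ltnS.
rewrite subSn // (@nprod_lincombl (k - d).+1%:R^-1 _ (lambda_bracket a b (k - d).+1)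
    (lambda_bracket (shift a) b (k - d))
    (shift (lambda_bracket a b (k - d)))) //; last first.
  by move=> i u; rewrite -lambda_modeS.
rewrite scalerA mulfV // scale1r subSS.
rewrite [n + d.+1%:Z](_ : _ = n + d%:Z + 1); last by lia.
by rewrite -nprod_shiftl addrA subrK.
Qed.

End Fields.

Theorem proposition3p6p1 (R : realType) (V : superspaceType R[i])
    (a b c : sfield V) (n : int) :
  lseries_of (lambda_bracket a (nprod n b c))
  = lsum (fun k : nat => (k`!%:R^-1 : R[i]) *:
        lmulX k (lseries_of (nprodsl (n + k%:Z) (lambda_bracket a b) c)))
    + psign a b *: lseries_of (nprodsr n b (lambda_bracket a c)).
Proof.
apply/funext => k; apply/funext => m; apply/funext => v.
rewrite /lseries_of /= lambda_mode_nprod fctE /lsum.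
rewrite (@fsum_ord _ k.+1); last first.
  by move=> d kd; rewrite /lmulX fctE leqNgt kd scaler0.
rewrite !fctE /= !fct_sumE; congr (_ + _); apply: eq_bigr => d _.
have dk : (d <= k)%N by rewrite -ltnS.
by rewrite !fctE /lmulX dk.
Qed.
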